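(* Suppose that $W_{\bm q}$ is surjective and let $p\in\mathcal{S}^k(\mathbb{K}^{n+1})$. Then $p$ admits a Waring decomposition on $V_{\bm q}$ if and only if $p\in\bm q\text{-}\mathrm{Sym}_{k,n+1}$.
   Context: Let $\mathbb{K}=\mathbb{R}$ or $\mathbb{C}$, and $m,n,k,h$ positive integers. $\mathcal{S}^d(\mathbb{K}^{N+1})$ is the space of homogeneous polynomials (forms) of degree $d$ in $N+1$ variables over $\mathbb{K}$. Variables are $\bm X=(X_0,\dots,X_n)$ for $\mathcal{S}^k(\mathbb{K}^{n+1})$ and $\bm Z=(Z_0,\dots,Z_m)$ for forms in $m+1$ variables. For a tuple $\bm v$, $\langle \bm v,\bm X\rangle=\sum_i v_iX_i$ (no conjugation), and $\bm v^{\bm\alpha}=\prod_i v_i^{\alpha_i}$. Let $\bm q=(q_0,\dots,q_n)$ with $q_i\in\mathcal{S}^h(\mathbb{K}^{m+1})$. The weight function is the linear map $W_{\bm q}:\mathcal{S}^k(\mathbb{K}^{n+1})\to\mathcal{S}^{hk}(\mathbb{K}^{m+1})$, $\bm X^{\bm\alpha}\mapsto \bm q(\bm Z)^{\bm\alpha}$. The apolar product on degree $d$ forms is the bilinear form $\langle f,g\rangle_d=\sum_{\bm\alpha}\binom{d}{\bm\alpha}^{-1}f_{\bm\alpha}g_{\bm\alpha}$ (where $f_{\bm\alpha},g_{\bm\alpha}$ are the monomial coefficients and $\binom{d}{\bm\alpha}=\frac{d!}{\prod\alpha_i!}$), and $A_d$ is the isomorphism $f\mapsto\langle f,\cdot\rangle_d$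 onto the dual space. Put $\phi_{\bm q}=A_k^{-1}\circ W_{\bm q}^*\circ A_{hk}:\mathcal{S}^{hk}(\mathbb{K}^{m+1})\to\mathcal{S}^k(\mathbb{K}^{n+1})$, where $W_{\bm q}^*$ is the transpose (pullback of functionals), and $\bm q\text{-}\mathrm{Sym}_{k,n+1}:=\mathrm{Im}(\phi_{\bm q})$. $\bm q$ defines a rational map $\mathbb{P}^m(\mathbb{K})\dashrightarrow\mathbb{P}^n(\mathbb{K})$, $[\bm Z]\mapsto[q_0(\bm Z):\cdots:q_n(\bm Z)]$; $V_{\bm q}$ denotes the Zariski closure in $\mathbb{P}^n(\mathbb{K})$ of its image. A Waring decomposition of $p$ on $V_{\bm q}$ is an expression $p=\sum_{i=1}^r\lambda_i\langle\bm\eta_i,\bm X\rangle^k$ with $r$ a positive integer, $\lambda_i\in\mathbb{K}\setminus\{0\}$, and $\bm\eta_i\in\mathbb{K}^{n+1}$ nonzero vectors corresponding to different points $[\bm\eta_i]$ of $\mathbb{P}^n(\mathbb{K})$, all lying in $V_{\bm q}$. *)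

(* Defs.v *)
From HB Require Import structures.
From mathcomp Require Import all_boot all_order all_algebra.
From mathcomp Require Import reals complex.
From mathcomp Require Import mpoly.

Set Implicit Arguments.
Unset Strict Implicit.
Unset Printing Implicit Defensive.

Import GRing.Theory Num.Theory.
Local Open Scope ring_scope.

(* S^d(K^{N+1}); note the arity shift: N.+1 variables, indexed by 'I_N.+1. *)
Notation hform K N d := (dhomog N.+1 K d).
Notation hform_dual K N d := 'Hom(hform K N d, K^o).

Section Apolar.
Variables (K : fieldType) (N : nat).

(* The division is exact when mdeg a = d, the only case used. *)
Definition multinom_coef (d : nat) (a : 'X_{1..N.+1}) : nat :=
  (d`! %/ \prod_(i < N.+1) (a i)`!)%N.

(* The bounded type 'X_{1..N.+1 < d.+1} (total degree at most d) only serves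
   to make the index set finite. *)
Definition apolar (d : nat) (f g : hform K N d) : K :=
  \sum_(a : 'X_{1..N.+1 < d.+1} | mdeg a == d)
     ((multinom_coef d a)%:R)^-1 * f@_a * g@_a.

Fact apolar_is_linear d (f : hform K N d) :
  linear (apolar f : hform K N d -> K^o).
Proof.
move=> c g h; rewrite /apolar scaler_sumr -big_split /=.
apply: eq_bigr => a _; rewrite mcoeffD mcoeffZ mulrDr; congr (_ + _).
by rewrite mulrCA.
Qed.

HB.instance Definition _ d (f : hform K N d) :=
  GRing.isLinear.Build K (hform K N d) K^o _ (apolar f) (apolar_is_linear f).

Definition apolar_fun d (f : hform K N d) : hform_dual K N d :=
  linfun (apolar f : hform K N d -> K^o).

Fact apolar_fun_is_linear d : linear (@apolar_fun d).
Proof.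
move=> c f g; apply/lfunP => h.
transitivity (c * apolar f h + apolar g h); last first.
  by rewrite add_lfunE scale_lfunE !lfunE.
rewrite lfunE /= /apolar mulr_sumr -big_split /=; apply: eq_bigr => a _.
rewrite mcoeffD mcoeffZ mulrDr mulrDl; congr (_ + _).
by rewrite (mulrCA _ c) -!mulrA.
Qed.

HB.instance Definition _ d :=
  GRing.isLinear.Build K (hform K N d) (hform_dual K N d) _ (@apolar_fun d)
    (@apolar_fun_is_linear d).

Definition apolar_iso d : 'Hom(hform K N d, hform_dual K N d) :=
  linfun (@apolar_fun d).

End Apolar.

(* In characteristic 0, apolar_iso is bijective, so that the (a priori partial)
   inverse (apolar_iso K N d)^-1%VF of linear functions is its inverse. *)
Lemma apolar_iso_bij (K : numFieldType) (N d : nat) :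
  lker (apolar_iso K N d) = 0%VS /\ limg (apolar_iso K N d) = fullv.
Proof.
have ker0 : lker (apolar_iso K N d) = 0%VS.
  apply/eqP; rewrite -subv0; apply/subvP => f; rewrite memv_ker memv0.
  rewrite lfunE /= => /eqP f0; apply/eqP/val_inj/mpolyP => a.
  rewrite mcoeff0; case: (mdeg a =P d) => [da|/eqP da]; last first.
    by apply: dhomog_nemf_coeff da; apply: dhomog_is_dhomog.
  have ha : 'X_[a] \is [in K[N.+1], d.-homog] by rewrite dhomogX; apply/eqP.
  have ad : (mdeg a < d.+1)%N by rewrite da.
  have := congr1 (fun u : hform_dual K N d => u (DHomog ha)) f0.
  rewrite /= lfunE lfunE /= /apolar (bigD1 (BMultinom ad)) ?da //= big1.
    rewrite addr0 mcoeffX eqxx mulr1 => /eqP; rewrite mulf_eq0 invr_eq0.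
    case/orP => [|/eqP //]; rewrite pnatr_eq0 /multinom_coef.
    rewrite -leqn0 leqNgt divn_gt0; last first.
      by apply: prodn_gt0 => i; apply: fact_gt0.
    suff -> : (\prod_(i < N.+1) (a i)`! <= d`!)%N by [].
    rewrite -da mdegE; elim/big_rec2: _ => // i x y _ le_xy.
    rewrite (leq_trans (leq_mul (leqnn _) le_xy)) //.
    rewrite -(@bin_fact (a i + y) (a i)) ?leq_addr // addKn.
    by rewrite leq_pmull // bin_gt0 leq_addr.
  move=> b /andP[_ neb]; rewrite mcoeffX; case: eqP => [eab|]; last by rewrite mulr0.
  by case/eqP: neb; apply/val_inj.
split=> //; apply/eqP; rewrite eqEdim subvf /=.
have := limg_ker_dim (apolar_iso K N d) fullv.
by rewrite ker0 capv0 dimv0 add0n => ->; rewrite !dimvf /dim /= muln1.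
Qed.

Section QSym.
Variables (K : fieldType) (m n k h : nat).
Variable q : 'I_n.+1 -> hform K m h.

Definition qtuple : n.+1.-tuple {mpoly K[m.+1]} :=
  [tuple mpoly_of_dhomog (q i) | i < n.+1].

Fact weight_subproof (f : hform K n k) : (f \mPo qtuple) \is (h * k).-homog.
Proof.
rewrite comp_mpolyEX big_seq rpred_sum //= => a a_f; apply: rpredZ.
rewrite comp_mpolyX.
have <- : mdeg a = k by apply: (dhomogP _ _ _ (dhomog_is_dhomog f)).
rewrite mdegE big_distrr /=; elim/big_rec2: _ => [|i x y _ hxy].
  exact: dhomog1.
by apply: dhomogM => //; apply: dhomogMn; rewrite tnth_mktuple dhomog_is_dhomog.
Qed.

Definition weight_fun (f : hform K n k) : hform K m (h * k) :=
  DHomog (weight_subproof f).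

Fact weight_fun_is_linear : linear weight_fun.
Proof. by move=> c f g; apply: val_inj; rewrite /= linearP. Qed.

HB.instance Definition _ :=
  GRing.isLinear.Build K (hform K n k) (hform K m (h * k)) _ weight_fun
    weight_fun_is_linear.

Definition weight : 'Hom(hform K n k, hform K m (h * k)) := linfun weight_fun.

Definition weight_pullback (u : hform_dual K m (h * k)) : hform_dual K n k :=
  (u \o weight)%VF.

Fact weight_pullback_is_linear : linear weight_pullback.
Proof.
by move=> c u v; rewrite /weight_pullback comp_lfunDl comp_lfunZl.
Qed.

HB.instance Definition _ :=
  GRing.isLinear.Build K (hform_dual K m (h * k)) (hform_dual K n k) _
    weight_pullback weight_pullback_is_linear.

Definition weight_transpose : 'Hom(hform_dual K m (h * k), hform_dual K n k) :=
  linfun weight_pullback.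

Definition qphi : 'Hom(hform K m (h * k), hform K n k) :=
  ((apolar_iso K n k)^-1 \o weight_transpose \o apolar_iso K m (h * k))%VF.

Definition qSym : {vspace hform K n k} := limg qphi.

End QSym.

(* P^N(K), as the set of lines of K^{N+1}. *)
Definition proj_space (K : fieldType) (N : nat) : Type :=
  {L : {vspace 'rV[K]_N.+1} | \dim L == 1%N}.

Fact proj_pt_subproof (K : fieldType) (N : nat) (v : 'rV[K]_N.+1) :
  v != 0 -> \dim <[v]>%VS == 1%N.
Proof. by rewrite dim_vline => ->. Qed.


Definition proj_pt (K : fieldType) (N : nat) (v : 'rV[K]_N.+1) (v0 : v != 0) :
  proj_space K N := exist _ <[v]>%VS (proj_pt_subproof v0).

Section Zariski.
Variables (K : fieldType) (N : nat).

Definition vanishes_at (d : nat) (F : hform K N d) (P : proj_space K N) : Prop :=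
  forall v : 'rV[K]_N.+1, v \in val P -> v != 0 ->
    (mpoly_of_dhomog F).@[fun i => v 0 i] = 0.

Definition zariski_closed (Z : proj_space K N -> Prop) : Prop :=
  exists S : forall d : nat, hform K N d -> Prop,
    forall P, Z P <-> forall d (F : hform K N d), S d F -> vanishes_at F P.

Definition zariski_closure (A : proj_space K N -> Prop) (P : proj_space K N) :
    Prop :=
  forall Z, zariski_closed Z -> (forall Q, A Q -> Z Q) -> Z P.

End Zariski.

Section Waring.
Variables (K : fieldType) (m n h : nat) (q : 'I_n.+1 -> hform K m h).

Definition qeval (z : 'rV[K]_m.+1) : 'rV[K]_n.+1 :=
  \row_i (mpoly_of_dhomog (q i)).@[fun j => z 0 j].

(* The image of the rational map [z] |-> [q_0(z) : ... : q_n(z)], which is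
   defined at [z] when the q_i(z) are not all zero. *)
Definition rational_image (P : proj_space K n) : Prop :=
  exists (z : 'rV[K]_m.+1) (z0 : z != 0) (qz0 : qeval z != 0),
    P = proj_pt qz0.

Definition Vq : proj_space K n -> Prop := zariski_closure rational_image.

Definition linear_form (v : 'rV[K]_n.+1) : {mpoly K[n.+1]} :=
  \sum_(i < n.+1) v 0 i *: 'X_i.

Definition has_Waring_decomposition_on (V : proj_space K n -> Prop)
    (k : nat) (p : hform K n k) : Prop :=
  exists (r : nat) (lambda : 'I_r -> K) (eta : 'I_r -> 'rV[K]_n.+1)
         (eta0 : forall i, eta i != 0),
    [/\ (0 < r)%N,
        forall i, lambda i != 0,
        injective (fun i => proj_pt (eta0 i)),
        forall i, V (proj_pt (eta0 i))
      & mpoly_of_dhomog p = \sum_(i < r) lambda i *: linear_form (eta i) ^+ k].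

End Waring.

(* Main.v *)
From HB Require Import structures.
Require Import Defs.
From mathcomp Require Import all_boot all_order all_algebra.
From mathcomp Require Import reals complex.
From mathcomp Require Import mpoly.

Import GRing.Theory Num.Theory.
Local Open Scope ring_scope.

(* The apolar product has the reproducing property <<z,Z>^d, g>_d = g(z).  Hence
   phi_q(<z,Z>^(hk)) = <q(z),X>^k, and since the powers <z,Z>^(hk) span the
   forms of degree hk, q-Sym is the span of the powers <q(z),X>^k.

   A form in the kernel of W_q vanishes on the image of q, hence on V_q.  So for
   eta in V_q the functional A_k(<eta,X>^k), evaluation at eta, factors through
   W_q, that is, <eta,X>^k lies in q-Sym.

   Conversely, surjectivity of W_q makes phi_q injective; therefore
   nonproportional powers <z_i,Z>^(hk) give nonzero vectors q(z_i) representing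
   distinct points, and it remains to write p as the image of a nontrivial
   combination of pairwise nonproportional powers. *)

(** * Factorials, digits and free families *)

Lemma prod_fact_dvdn_mdeg (n d : nat) (a : 'X_{1..n}) :
  mdeg a = d -> (\prod_(i < n) (a i)`! %| d`!)%N.
Proof.
move=> <-; rewrite mdegE; elim/big_rec2: _ => // i x y _ dvd_xy.
rewrite -(@bin_fact (a i + y) (a i)) ?leq_addr // addKn.
by rewrite dvdn_mull // dvdn_mul.
Qed.

(** The residue and the quotient by [B] isolate the lowest digit and the remaining ones. This keeps
    the exponents of a Kronecker substitution apart. *)
Lemma base_digits_inj (n B : nat) (a b : 'I_n -> nat) :
    (forall i, a i < B)%N -> (forall i, b i < B)%N ->
  (\sum_(i < n) a i * B ^ i = \sum_(i < n) b i * B ^ i)%N -> a =1 b.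
Proof.
elim: n a b => [|n IHn] a b ltaB ltbB; first by move=> _ [].
have B0 : (0 < B)%N by apply: leq_ltn_trans (leq0n _) (ltaB ord0).
have splitE (c : 'I_n.+1 -> nat) : (\sum_(i < n.+1) c i * B ^ i
    = (\sum_(i < n) c (lift ord0 i) * B ^ i) * B + c ord0)%N.
  rewrite big_ord_recl expn0 muln1 addnC; congr (_ + _).
  rewrite big_distrl; apply: eq_bigr => i _ /=.
  by rewrite /bump add1n expnSr mulnA.
rewrite !splitE => eq_ab.
have := congr1 (fun x => (x %% B)%N) eq_ab.
rewrite !modnMDl !modn_small // => ab0.
have := congr1 (fun x => (x %/ B)%N) eq_ab.
rewrite !divnMDl // !divn_small // !addn0 => /IHn abS i.
case: (unliftP ord0 i) => [j|] -> //.
exact: abS.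
Qed.

(** A free list has at most [\dim {:V}] entries, so extending it by values outside its span must
    stop, even when [T] is infinite. *)
Lemma maximal_free_family {K : fieldType} {V : vectType K} {T : Type}
    (F : T -> V) :
  exists s, free (map F s) /\ forall t, F t \in <<map F s>>%VS.
Proof.
apply: boolp.contrapT => no_max.
suff [s [fs szs]] : exists s, free (map F s) /\ size s = (\dim {:V}).+1.
  have := dimvS (subvf <<map F s>>%VS).
  by rewrite (eqP fs) size_map szs ltnn.
elim: _.+1 => [|r [s [fs szs]]]; first by exists [::]; rewrite nil_free.
have /boolp.existsNP[t /negP Ft] : ~ forall t, F t \in <<map F s>>%VS.
  by move=> all_s; apply: no_max; exists s.
by exists (t :: s); rewrite /= szs free_cons Ft.
Qed.

(** * Powers of linear forms and the apolar product *)

Section Powers.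
Context {K : numFieldType} {N : nat}.
Implicit Types (v : 'rV[K]_N.+1) (d : nat).

Lemma linear_form_homog v : linear_form v \is 1.-homog.
Proof.
by apply: rpred_sum => i _; apply: rpredZ; rewrite dhomogX; apply/eqP/mdeg1.
Qed.

Fact power_form_subproof d v : linear_form v ^+ d \is d.-homog.
Proof. by have := dhomogMn d (linear_form_homog v); rewrite mul1n. Qed.

Definition power_form d v : hform K N d := DHomog (power_form_subproof d v).

Lemma mderiv_linear_form_exp v d i :
  (linear_form v ^+ d)^`M(i) = (v 0 i *+ d) *: linear_form v ^+ d.-1.
Proof.
have dL : (linear_form v)^`M(i) = (v 0 i)%:MP.
  rewrite /linear_form raddf_sum (bigD1 i) //= big1 => [|j neji].
    have U0 : (U_(i) - U_(i))%MM = 0%MM :> 'X_{1..N.+1}.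
      by apply/mnmP => j; rewrite mnmBE mnm0E subnn.
    by rewrite addr0 mderivZ mderivX mnm1E eqxx U0 mpolyX0 scale1r alg_mpolyC.
  by rewrite mderivZ mderivX mnm1E (negPf neji) scale0r scaler0.
elim: d => [|d IHd]; first by rewrite expr0 mderivC scale0r.
rewrite exprS mderivM IHd dL mul_mpolyC /= -scalerAr mulrS scalerDl.
by congr (_ + _); case: d {IHd} => [|d]; rewrite ?mulr0n ?scale0r // -exprS.
Qed.

(** The multinomial theorem, by induction on the degree through partial derivatives. *)
Lemma mcoeff_linear_form_exp v d (a : 'X_{1..N.+1}) : mdeg a = d ->
  (linear_form v ^+ d)@_a = (multinom_coef d a)%:R * \prod_i v 0 i ^+ a i.
Proof.
have fact0 (b : 'X_{1..N.+1}) : (\prod_i (b i)`!)%:R != 0 :> K.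
  by rewrite pnatr_eq0 -lt0n; apply: prodn_gt0 => i; apply: fact_gt0.
(* The truncated division is exact here, so the denominator can be cleared before the induction. *)
move=> da; have -> : (multinom_coef d a)%:R
    = d`!%:R / (\prod_i (a i)`!)%:R :> K.
  apply/(canRL (mulfK (fact0 a))); rewrite -natrM divnK //.
  exact: prod_fact_dvdn_mdeg.
rewrite mulrAC; apply/(canRL (mulfK (fact0 a))).
elim: d a da => [|d IHd] a da.
  have -> : a = 0%MM by apply/eqP; rewrite -mdeg_eq0 da.
  rewrite expr0 mcoeff1 eqxx !mul1r.
  by rewrite !big1 // => i _; rewrite mnm0E.
have [i ai] : exists i, (0 < a i)%N.
  apply/existsP; apply: contraPT da; rewrite negb_exists => /forallP a0.
  by rewrite mdegE big1 // => i _; apply/eqP; rewrite -leqn0 leqNgt.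
set b := (a - U_(i))%MM; have ab : a = (b + U_(i))%MM.
  apply/esym/submK/mnm_lepP => j; rewrite mnm1E.
  by case: eqP => // <-.
have db : mdeg b = d by move: da; rewrite ab mdegD mdeg1 addn1 => -[].
(* The coefficient of ['X_[b]] in the derivative of L^(d+1) relates the coefficient of L^(d+1) at
   [a] to that of L^d at [b], with factors a_i and (d+1) v_i. *)
have := congr1 (mcoeff b) (mderiv_linear_form_exp v d.+1 i).
rewrite mcoeff_mderiv -ab mcoeffZ /= => cE.
have prodE (F : 'I_N.+1 -> nat -> K) :
  \prod_j F j (a j) = F i (b i).+1 * \prod_(j | j != i) F j (b j).
  rewrite (bigD1 i) //= ab mnmDE mnm1E eqxx addn1; congr (_ * _).
  by apply: eq_bigr => j /negPf nej; rewrite mnmDE mnm1E eq_sym nej addn0.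
have {}IHd := IHd b db.
rewrite natr_prod (prodE (fun _ e => e`!%:R)) /=.
rewrite (prodE (fun j e => v 0 j ^+ e)) /=.
rewrite natr_prod (bigD1 i) //= [X in _ = _ * X](bigD1 i) //= in IHd.
rewrite !factS !natrM (exprS (v 0 i)) -!mulrA.
rewrite (mulrA (_@_a)) mulr_natr cE -mulrA IHd -[v 0 i *+ _]mulr_natl.
by rewrite -!mulrA (mulrCA (v 0 i)).
Qed.

Lemma meval_hform d (g : hform K N d) (v : 'I_N.+1 -> K) :
  (mpoly_of_dhomog g).@[v]
    = \sum_(a : 'X_{1..N.+1 < d.+1} | mdeg a == d) g@_a * \prod_i v i ^+ a i.
Proof.
have gE : mpoly_of_dhomog g = \sum_(a : 'X_{1..N.+1 < d.+1}) g@_a *: 'X_[a].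
  apply/mpolyP => a; case: (ltnP (mdeg a) d.+1) => [lt_ad|gt_ad].
    by rewrite (mcoeff_mpoly (fun m => g@_m)).
  have -> : g@_a = 0.
    apply: dhomog_nemf_coeff (dhomog_is_dhomog g) _.
    by rewrite neq_ltn /= gt_ad orbT.
  rewrite raddf_sum big1 //= => b _; rewrite mcoeffZ mcoeffX.
  case: eqP gt_ad => [<-|]; last by rewrite mulr0.
  by rewrite ltnNge -ltnS bmdeg.
rewrite [in LHS]gE raddf_sum [RHS]big_mkcond; apply: eq_bigr => a _ /=.
rewrite mevalZ mevalX; case: eqP => // /eqP da.
rewrite (_ : g@_a = 0) ?mul0r //.
exact: dhomog_nemf_coeff (dhomog_is_dhomog g) da.
Qed.

(** The weights of the apolar product cancel the multinomial coefficients of the power. *)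
Lemma apolar_power_form {d} v (g : hform K N d) :
  apolar (power_form d v) g = (mpoly_of_dhomog g).@[fun i => v 0 i].
Proof.
rewrite meval_hform; apply: eq_bigr => a /eqP da.
rewrite mcoeff_linear_form_exp // mulrC mulKf //.
rewrite pnatr_eq0 -lt0n /multinom_coef divn_gt0; last first.
  by apply: prodn_gt0 => i; apply: fact_gt0.
apply: dvdn_leq; first exact: fact_gt0.
exact: prod_fact_dvdn_mdeg.
Qed.

Lemma apolar_inj {d} : injective (@apolar_fun K N d).
Proof.
have [ker0 _] := apolar_iso_bij K N d.
move=> f g; move/lker0P: (introT eqP ker0) => inj fg; apply: inj.
by rewrite !lfunE.
Qed.

Lemma apolar_surj {d} (u : hform_dual K N d) : exists f, apolar_fun f = u.
Proof.
have [_ im] := apolar_iso_bij K N d.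
have : u \in limg (apolar_iso K N d) by rewrite im memvf.
by case/memv_imgP => f _ ->; exists f; rewrite lfunE.
Qed.

Lemma apolar_iso_invK {d} (f : hform K N d) :
  (apolar_iso K N d)^-1%VF (apolar_fun f) = f.
Proof.
have [ker0 _] := apolar_iso_bij K N d.
by have := lker0_lfunK (introT eqP ker0) f; rewrite [X in (_^-1)%VF X]lfunE.
Qed.

(* Kronecker substitution: evaluating at (t, t^B, t^(B^2), ...) turns f into a
   univariate polynomial with the same coefficients. *)
Lemma hform_eq0 {d} (f : hform K N d) :
  (forall v : 'rV[K]_N.+1, (mpoly_of_dhomog f).@[fun i => v 0 i] = 0) -> f = 0.
Proof.
(* Exponents in degree [d] are at most [d], hence digits in base [d.+1]. *)
move=> f0; pose B := d.+1.
pose kr (a : 'X_{1..N.+1}) := (\sum_(i < N.+1) a i * B ^ i)%N.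
pose P : {poly K} :=
  \sum_(a : 'X_{1..N.+1 < d.+1} | mdeg a == d) f@_a *: 'X^(kr a).
have Pt t : P.[t] = 0.
  rewrite -(f0 (\row_i t ^+ (B ^ i))) meval_hform horner_sum.
  apply: eq_bigr => a _; rewrite hornerZ hornerXn; congr (_ * _).
  rewrite /kr expr_sum; apply: eq_bigr => i _.
  by rewrite mxE mulnC exprM.
have P0 : P = 0.
  apply/eqP; apply: contraT => nzP.
  (* In characteristic 0 the naturals below [size P] are distinct roots, one too many for a nonzero
     [P]. *)
  have /(max_poly_roots nzP) : all (root P) [seq i%:R | i <- iota 0 (size P)].
    by apply/allP => x _; apply/rootP.
  rewrite size_map size_iota ltnn => -> //.
  rewrite map_inj_uniq ?iota_uniq //.
  by move=> i j /eqP; rewrite eqr_nat => /eqP.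
apply/val_inj/mpolyP => a; rewrite mcoeff0.
case: (mdeg a =P d) => [da|/eqP da]; last first.
  exact: dhomog_nemf_coeff (dhomog_is_dhomog f) da.
have lt_digit (b : 'X_{1..N.+1}) : mdeg b = d -> forall i, (b i < B)%N.
  by move=> db i; rewrite /B ltnS -db mdegE (bigD1 i) //= leq_addr.
have ad : (mdeg a < d.+1)%N by rewrite da.
have := congr1 (fun p : {poly K} => p`_(kr a)) P0; rewrite /P coef_sum coef0.
rewrite (bigD1 (BMultinom ad)) ?da //= big1 ?addr0.
  by rewrite coefZ coefXn eqxx mulr1.
move=> b /andP[/eqP db neb]; rewrite coefZ coefXn.
case: eqP => [/esym eq_kr|]; last by rewrite mulr0.
case/eqP: neb; apply/val_inj/mnmP/(@base_digits_inj _ B) => //; exact: lt_digit.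
Qed.

Lemma apolarC {d} (f g : hform K N d) : apolar f g = apolar g f.
Proof. by apply: eq_bigr => a _; rewrite mulrAC. Qed.

Lemma meval_linear_form v (w : 'I_N.+1 -> K) :
  (linear_form v).@[w] = \sum_i v 0 i * w i.
Proof.
rewrite /linear_form raddf_sum; apply: eq_bigr => i _ /=.
by rewrite mevalZ mevalXU.
Qed.

Lemma power_formZ d c v : power_form d (c *: v) = c ^+ d *: power_form d v.
Proof.
apply: val_inj => /=; rewrite -exprZn; congr (_ ^+ _).
by rewrite /linear_form scaler_sumr; apply: eq_bigr => i _; rewrite mxE scalerA.
Qed.

Lemma power_form0 {d} : (0 < d)%N -> power_form d (0 : 'rV[K]_N.+1) = 0.
Proof.
by move=> d0; rewrite -(scale0r 0) power_formZ expr0n gtn_eqF ?scale0r.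
Qed.

(** A form orthogonal to a maximal free family of powers is orthogonal to every power, so it
    vanishes everywhere and is 0. Pairing with the family is thus injective, which bounds the
    dimension by the size of the family. *)
Lemma power_forms_span d : exists s : seq 'rV[K]_N.+1,
  free (map (power_form d) s) /\ <<map (power_form d) s>>%VS = fullv.
Proof.
have [s [fs max_s]] := maximal_free_family (power_form d).
exists s; split=> //; apply/eqP; rewrite eqEdim subvf /= (eqP fs) size_map.
pose ev (f : hform K N d) : 'rV[K]_(size s) :=
  \row_j apolar f (power_form d (nth 0 s j)).
have ev_lin : linear ev.
  move=> c f g; apply/rowP => j.
  by rewrite !mxE ![apolar _ (power_form _ _)]apolarC linearP.
pose evL := GRing.isLinear.Build _ _ _ _ ev ev_lin.
pose evl : {linear hform K N d -> 'rV[K]_(size s)} := HB.pack ev evL.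
have ker0 : lker (linfun evl) = 0%VS.
  apply/eqP; rewrite -subv0; apply/subvP => f; rewrite memv_ker memv0 lfunE /=.
  move=> /eqP ev0; apply/eqP/hform_eq0 => v; rewrite -apolar_power_form apolarC.
  suff : power_form d v \in lker (apolar_fun f).
    by rewrite memv_ker lfunE => /eqP.
  apply: subvP (max_s v); apply/span_subvP => _ /mapP[w /(nthP 0)[j js <-] ->].
  rewrite memv_ker lfunE /=; have /rowP/(_ (Ordinal js)) := ev0.
  by rewrite !mxE => ->.
have := limg_ker_dim (linfun evl) fullv; rewrite ker0 capv0 dimv0 add0n => <-.
have := dimvS (subvf (limg (linfun evl))).
by rewrite [X in (_ <= X)%N]dimvf /dim /= mul1n.
Qed.

End Powers.

(** * The map phi_q and decompositions on V_q *)

Section Weight.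
Context {K : numFieldType} {m n k h : nat} (q : 'I_n.+1 -> hform K m h).

Lemma meval_weight (f : hform K n k) (z : 'rV[K]_m.+1) :
  (mpoly_of_dhomog (weight k q f)).@[fun i => z 0 i]
    = (mpoly_of_dhomog f).@[fun i => qeval q z 0 i].
Proof.
rewrite lfunE /= comp_mpoly_meval; apply: meval_eq => i.
by rewrite tnth_mktuple mxE.
Qed.

(** Adjointness of phi_q and W_q; later arguments use it in place of the definition of [qphi]. *)
Lemma apolar_qphi (g : hform K m (h * k)) :
  apolar_fun (qphi k q g) = (apolar_fun g \o weight k q)%VF.
Proof.
have [f fE] := apolar_surj (apolar_fun g \o weight k q)%VF.
rewrite -fE; congr apolar_fun; rewrite -[RHS]apolar_iso_invK fE.
by rewrite !comp_lfunE [apolar_iso _ _ _ g]lfunE [weight_transpose _ _ _]lfunE.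
Qed.

Lemma qphi_power_form (z : 'rV[K]_m.+1) :
  qphi k q (power_form (h * k) z) = power_form k (qeval q z).
Proof.
apply/apolar_inj; rewrite apolar_qphi; apply/lfunP => f.
by rewrite comp_lfunE [LHS]lfunE [RHS]lfunE /= !apolar_power_form meval_weight.
Qed.

Lemma power_form_Vq_qSym (eta : 'rV[K]_n.+1) (eta0 : eta != 0) :
  Vq q (proj_pt eta0) -> power_form k eta \in qSym k q.
Proof.
move=> Veta.
have eta_ker (f : hform K n k) : weight k q f = 0 ->
    (mpoly_of_dhomog f).@[fun i => eta 0 i] = 0.
  move=> Wf0; apply: (Veta (vanishes_at f)) => [|P [z [z0 [qz0 ->]]] v| |//].
  (* The closed set is the hypersurface f = 0. Its equation is compared as a polynomial because the
     degree of [F] varies. *)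
  - exists (fun d F => mpoly_of_dhomog F = mpoly_of_dhomog f) => P.
    split=> [fP d F Ff v|]; first by rewrite Ff; apply: fP.
    exact.
  - move=> /vlineP[c ->] _; rewrite -apolar_power_form power_formZ apolarC.
    rewrite linearZ /= apolarC apolar_power_form -meval_weight Wf0.
    by rewrite meval0 scaler0.
  - exact: memv_line.
(* [g] represents evaluation at [eta] after a partial inverse of W_q. The choice of preimage is
   harmless: two of them differ by an element of the kernel, which vanishes at [eta]. *)
have [g gE] :=
  apolar_surj (apolar_fun (power_form k eta) \o (weight k q)^-1)%VF.
apply/memv_imgP; exists g; first exact: memvf.
apply/apolar_inj; rewrite apolar_qphi gE; apply/lfunP => f.
rewrite !comp_lfunE; apply/eqP; rewrite -subr_eq0 -linearB /=.
rewrite lfunE /= apolar_power_form eta_ker //.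
by rewrite linearB /= limg_lfunVK ?subrr // memv_img // memvf.
Qed.

Hypothesis weight_surj : forall g, exists f, weight k q f = g.

Lemma qphi_inj : injective (qphi k q).
Proof.
move=> g1 g2 eq_g; apply/apolar_inj/lfunP => g; have [f <-] := weight_surj g.
by rewrite -!comp_lfunE -!apolar_qphi eq_g.
Qed.

(** The powers need only be nonzero and pairwise nonproportional, not free, so that a linear
    relation among them can serve to decompose 0. *)
Lemma Waring_of_power_forms {r : nat} (c : 'I_r -> K)
    (z : 'I_r -> 'rV[K]_m.+1) :
    (0 < h)%N -> (0 < k)%N ->
    (exists i, c i != 0) ->
    (forall i, power_form (h * k) (z i) != 0) ->
    (forall i j a, power_form (h * k) (z i) = a *: power_form (h * k) (z j) ->
      i = j) ->
  has_Waring_decomposition_on (Vq q)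
    (qphi k q (\sum_(i < r) c i *: power_form (h * k) (z i))).
Proof.
(* Terms with zero coefficient are dropped, since all weights must be nonzero. *)
move=> h0 k0 [i0 ci0] Lz0 Lz_inj; pose A := [pred i | c i != 0].
have z0 i : z i != 0.
  apply: contraNneq (Lz0 i) => ->; rewrite power_form0 ?eqxx //.
  by rewrite muln_gt0 h0.
have qz0 i : qeval q (z i) != 0.
  apply: contraNneq (Lz0 i) => qz0; apply/eqP/qphi_inj.
  by rewrite qphi_power_form qz0 power_form0 ?linear0.
exists #|A|, (fun i => c (enum_val i)), (fun i => qeval q (z (enum_val i))).
exists (fun i => qz0 (enum_val i)); split.
- by apply/card_gt0P; exists i0.
- by move=> i; have := enum_valP i.
(* Equal points give q(z_i) = a q(z_j), hence proportional k-th powers, and injectivity of phi_q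
   lifts this to the powers of z_i and z_j. *)
- move=> i j /(congr1 val) /= eq_ij; apply/enum_val_inj.
  have /vlineP[a qzE] : qeval q (z (enum_val i))
      \in <[qeval q (z (enum_val j))]>%VS.
    by rewrite -eq_ij memv_line.
  apply: (Lz_inj _ _ (a ^+ k)); apply: qphi_inj.
  by rewrite linearZ /= !qphi_power_form qzE power_formZ.
- move=> i Z _; apply; exists (z (enum_val i)), (z0 _), (qz0 _) => //.
- rewrite linear_sum raddf_sum /= (bigID A) /= [X in _ + X]big1 ?addr0.
    rewrite big_enum_val; apply: eq_bigr => i _.
    by rewrite linearZ /= qphi_power_form.
  by move=> i /negbNE/eqP ->; rewrite scale0r linear0.
Qed.

(* [0] needs a nonempty decomposition too: it comes from a linear relation
   between the powers attached to the points [1 : 0 : ... : 0 : i]. *)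
Lemma Waring0 : (0 < m)%N -> (0 < h)%N -> (0 < k)%N ->
  has_Waring_decomposition_on (Vq q) (0 : hform K n k).
Proof.
move=> m0 h0 k0; pose d := (h * k)%N.
have d0 : (0 < d)%N by rewrite muln_gt0 h0.
pose z (t : K) : 'rV[K]_m.+1 :=
  \row_j ((j == ord0)%:R + t * (j == ord_max)%:R).
have evz t (w : 'I_m.+1 -> K) : (mpoly_of_dhomog (power_form d (z t))).@[w]
    = (w ord0 + t * w ord_max) ^+ d.
  rewrite /= rmorphXn /= meval_linear_form; congr (_ ^+ _).
  under eq_bigr do rewrite mxE mulrDl.
  rewrite big_split /= (bigD1 ord0) //= big1 ?addr0 ?mul1r => [|j /negPf ->].
    rewrite (bigD1 ord_max) //= big1 ?addr0 ?eqxx ?mulr1 // => j /negPf ->.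
    by rewrite mulr0 mul0r.
  by rewrite mul0r.
(* One more power than the dimension forces a relation. *)
pose r := (\dim {: hform K m d}).+1.
pose L (i : 'I_r) := power_form d (z (i : nat)%:R).
have nfree : ~ free [tuple L i | i < r].
  move/eqP => dimL; have := dimvS (subvf <<[tuple L i | i < r]>>%VS).
  by rewrite dimL size_tuple ltnn.
have [c [cL [i ci]]] :
    exists c, \sum_(i < r) c i *: L i = 0 /\ exists i, c i != 0.
  apply: boolp.contrapT => no_c; apply: nfree; apply/freeP => c cL i.
  apply/eqP; apply: contraT => ci; case: no_c; exists c.
  split; last by exists i.
  by rewrite -[RHS]cL; apply: eq_bigr => j _; rewrite -tnth_nth tnth_mktuple.
rewrite -(linear0 (qphi k q)) -cL.
have max0 : (ord_max == ord0 :> 'I_m.+1) = false.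
  by apply/negbTE; rewrite -val_eqE -lt0n.
apply: Waring_of_power_forms => //; first by exists i.
- move=> j; apply/eqP => Lj0.
  have := evz (j : nat)%:R (fun l => (l == ord0)%:R).
  rewrite [power_form _ _]Lj0.
  rewrite meval0 eqxx max0 mulr0 addr0 expr1n => /eqP.
  by rewrite eq_sym oner_eq0.
move=> i1 i2 a eqL.
have evL (w' : 'I_m.+1 -> K) : (w' ord0 + (i1 : nat)%:R * w' ord_max) ^+ d
    = a * (w' ord0 + (i2 : nat)%:R * w' ord_max) ^+ d.
  by rewrite -!evz eqL /= mevalZ.
(* At this point the right side vanishes, leaving (i1 - i2)^d = 0. *)
have := evL (fun j => if j == ord0 then - (i2 : nat)%:R else 1).
rewrite eqxx max0 !mulr1 addNr expr0n gtn_eqF // mulr0 => /eqP.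
rewrite expf_eq0 d0 /= addrC subr_eq0 eqr_nat => /eqP.
exact: val_inj.
Qed.

Lemma qSym_Waring (p : hform K n k) :
    (0 < m)%N -> (0 < h)%N -> (0 < k)%N -> p \in qSym k q ->
  has_Waring_decomposition_on (Vq q) p.
Proof.
move=> m0 h0 k0 /memv_imgP[g _ pE].
(* For p = 0 the coordinates used below could all vanish, leaving an empty sum. *)
have [->|p0] := eqVneq p 0; first exact: Waring0.
have [s [fs span_s]] := @power_forms_span K m (h * k).
pose X := in_tuple (map (power_form (h * k)) s).
have XE (i : 'I_(size (map (power_form (h * k)) s))) :
    power_form (h * k) (nth 0 s i) = X`_i.
  by rewrite (nth_map 0) // -(size_map (power_form (h * k))).
have gE : g = \sum_i coord X i g *: power_form (h * k) (nth 0 s i).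
  by under eq_bigr do rewrite XE; apply: coord_span; rewrite span_s memvf.
rewrite pE gE; apply: Waring_of_power_forms => //.
- apply: boolp.contrapT => no_c; case/negP: p0; rewrite pE gE.
  rewrite big1 ?linear0 // => i _; case: (eqVneq (coord X i g) 0) => [->|ci].
    by rewrite scale0r.
  by case: no_c; exists i.
(* Reading off the i-th coordinate shows that members of a free family are nonzero and pairwise
   nonproportional. *)
- move=> i; rewrite XE; apply/eqP => /(congr1 (coord X i)).
  by rewrite coord_free // eqxx linear0 => /eqP; rewrite oner_eq0.
- move=> i j a; rewrite !XE => /(congr1 (coord X i)).
  rewrite linearZ /= !coord_free // eqxx; case: eqP => // _ /eqP.
  by rewrite mulr0 oner_eq0.
Qed.

End Weight.

(** * The equivalence over the real and complex fields *)

Lemma Waring_on_Vq_qSym (K : numFieldType) (m n k h : nat)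
    (q : 'I_n.+1 -> hform K m h) (p : hform K n k) :
  has_Waring_decomposition_on (Vq q) p -> p \in qSym k q.
Proof.
move=> [r [c [eta [eta0 [_ _ _ Veta pE]]]]].
have -> : p = \sum_(i < r) c i *: power_form k (eta i).
  by apply: val_inj; rewrite /= pE raddf_sum.
apply: memv_suml => i _; apply: memvZ.
exact: (power_form_Vq_qSym _ _ (eta0 i)).
Qed.

Theorem theorem3p18 (R : realType) (K : fieldType)
    (hK : K = R :> fieldType \/ K = R[i] :> fieldType)
    (m n k h : nat) (hm : (0 < m)%N) (hn : (0 < n)%N) (hk : (0 < k)%N)
    (hh : (0 < h)%N)
    (q : 'I_n.+1 -> hform K m h)
    (hW : forall g : hform K m (h * k), exists f : hform K n k, weight k q f = g)
    (p : hform K n k) :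
  has_Waring_decomposition_on (Vq q) p <-> p \in qSym k q.
Proof.
case: hK => KE; subst K.
  by split; [apply: Waring_on_Vq_qSym | apply: qSym_Waring].
by split; [apply: Waring_on_Vq_qSym | apply: qSym_Waring].
Qed.
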